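(* There exists a universal constant $c>1$ such that for every sufficiently large $n>0$ the following holds. Let $\mathsf{RO}:\{0,1\}^n\to\{0,1\}^n$ be a random oracle. For any memory size $S$ with $n\leq S<2^{O(n)}$ and any running time $S\leq T<2^{O(n)}$, there is an oracle function $f:\{0,1\}^S\to\{0,1\}^n$ such that it can be computed in time $O(T\cdot n)$ using memory of size $O(S)$ by a RAM algorithm with oracle access to $\mathsf{RO}$, while any randomized massively parallel computation $\mathcal{A}^{\mathsf{RO}}$ with $m<2^{O(n)}$ machines, local memory of size $s\leq S/c$, and fewer than $q<2^{O(n)}$ queries to $\mathsf{RO}$ per machine per round needs at least $R\geq\Omega(T/s)$ rounds to compute $f$ in the average case.
   Context: A random oracle $\mathsf{RO}:\{0,1\}^n\to\{0,1\}^n$ is uniformly random among all such functions; a query costs $O(n)$ RAM time. MPC with a random oracle: $m$ machines each with $s$-bit local memory, a shared read-only random tape, and oracle access to $\mathsf{RO}$. The input $x\in\{0,1\}^N$ is split arbitrarily among the machines. In synchronous rounds $k=0,1,\dots$ each machine computes on its local memory and the shared tape with adaptive queries to $\mathsf{RO}$ (at most $q$ per round), then sends messages to machines; each machine receives at most $s$ bits in total, which form its memory for the next round. After $R$ rounds the output is the union of the machines' outputs. Computing $f$ in the average case means that for uniformly random input (arbitrarily distributed) the output equals $f(x)$ with probability at least $1/3$ over the input, the algorithm's randomness and the oracle. *)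

(* Defs.v *)
From HB Require Import structures.
From mathcomp Require Import all_boot all_order all_algebra.
From mathcomp Require Import reals.

Set Implicit Arguments.
Unset Strict Implicit.
Unset Printing Implicit Defensive.

Import Order.TTheory GRing.Theory Num.Theory.

Local Open Scope nat_scope.

Definition word (n : nat) := n.-tuple bool.

Definition oracle (n : nat) := {ffun word n -> word n}.

Definition oracle_function (n N : nat) := oracle n -> N.-tuple bool -> n.-tuple bool.

Definition pr (R : realType) (T : finType) (E : pred T) : R :=
  (#|E|%:R / #|T|%:R)%R.

(** * RAM with oracle access

   A word RAM with n-bit words.  Every instruction takes one unit of time,
   except an oracle query, which takes n.  A machine has a fixed number M of
   memory cells, i.e. M * n bits, which hold the input, the working space and
   the output; there are no registers besides the program counter, and any
   access outside the M cells blocks the machine. *)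

(* Little-endian value; [word_of_nat] reduces modulo 2 ^ n. *)
Definition nat_of_word n (w : word n) : nat := \sum_(i < n) tnth w i * 2 ^ i.
Definition word_of_nat n (k : nat) : word n :=
  [tuple odd (k %/ 2 ^ i) | i < n].

Inductive binop := Add | Sub | And | Or | Xor | Shl | Shr.

Definition bitwise n (g : bool -> bool -> bool) (a b : word n) : word n :=
  [tuple g (tnth a i) (tnth b i) | i < n].

Definition eval_binop n (o : binop) (a b : word n) : word n :=
  match o with
  | Add => word_of_nat n (nat_of_word a + nat_of_word b)
  | Sub => word_of_nat n (nat_of_word a + (2 ^ n - nat_of_word b))
  | And => bitwise andb a b
  | Or  => bitwise orb a b
  | Xor => bitwise addb a b
  | Shl => word_of_nat n (nat_of_word a * 2 ^ nat_of_word b)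
  | Shr => word_of_nat n (nat_of_word a %/ 2 ^ nat_of_word b)
  end.

Inductive instr (n : nat) :=
| Const (d : nat) (k : word n)        (* mem[d] := k *)
| Binop (o : binop) (d a b : nat)     (* mem[d] := mem[a] o mem[b] *)
| LoadInd (d a : nat)                 (* mem[d] := mem[mem[a]] *)
| StoreInd (a b : nat)                (* mem[mem[a]] := mem[b] *)
| Query (d a : nat)                   (* mem[d] := RO(mem[a]) *)
| Jump (l : nat)
| JumpLt (a b l : nat)                (* if mem[a] < mem[b] goto l *)
| Halt.
Arguments LoadInd {n}.
Arguments Binop {n}.
Arguments StoreInd {n}.
Arguments Query {n}.
Arguments Jump {n}.
Arguments JumpLt {n}.
Arguments Halt {n}.

Definition ram_program (n : nat) := seq (instr n).
Definition memory (n : nat) := seq (word n).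

Definition read n (mem : memory n) (a : nat) : option (word n) := onth mem a.

Definition write n (mem : memory n) (a : nat) (w : word n) : option (memory n) :=
  if a < size mem then Some (set_nth w mem a w) else None.

Definition instr_cost n (i : instr n) : nat :=
  if i is Query _ _ then n else 1.

(* The next program counter and memory; [None] on [Halt] and on an
   out-of-range access. *)
Definition ram_step n (RO : oracle n) (i : instr n) (pc : nat) (mem : memory n) :
    option (nat * memory n) :=
  let next := omap (pair pc.+1) in
  match i with
  | Const d k => next (write mem d k)
  | Binop o d a b =>
      obind (fun x => obind (fun y => next (write mem d (eval_binop o x y)))
        (read mem b)) (read mem a)
  | LoadInd d a =>
      obind (fun p => obind (fun x => next (write mem d x))
        (read mem (nat_of_word p))) (read mem a)
  | StoreInd a b =>
      obind (fun p => obind (fun x => next (write mem (nat_of_word p) x))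
        (read mem b)) (read mem a)
  | Query d a => obind (fun x => next (write mem d (RO x))) (read mem a)
  | Jump l => Some (l, mem)
  | JumpLt a b l =>
      obind (fun x => obind (fun y =>
        Some (if nat_of_word x < nat_of_word y then l else pc.+1, mem))
        (read mem b)) (read mem a)
  | Halt => None
  end.

(* [ram_run P RO pc mem t mem'] : started at [pc] with memory [mem], the program
   halts after time exactly [t] with memory [mem']. *)
Inductive ram_run n (P : ram_program n) (RO : oracle n) :
    nat -> memory n -> nat -> memory n -> Prop :=
| ram_run_halt pc mem :
    onth P pc = Some Halt -> ram_run P RO pc mem 1 mem
| ram_run_step pc mem i pc' mem' t mem'' :
    onth P pc = Some i -> ram_step RO i pc mem = Some (pc', mem') ->
    ram_run P RO pc' mem' t mem'' ->
    ram_run P RO pc mem (instr_cost i + t) mem''.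

(* The input is packed n bits per cell from cell 0 on, padded with zeros. *)
Definition ram_init n N (M : nat) (x : N.-tuple bool) : memory n :=
  mkseq (fun j => [tuple nth false x (j * n + i) | i < n]) M.

(* The n-bit result is left in cell 0. *)
Definition ram_computes n N (P : ram_program n) (M time : nat)
    (f : oracle_function n N) : Prop :=
  N <= M * n /\
  forall (RO : oracle n) (x : N.-tuple bool),
    exists t mem, [/\ t <= time, ram_run P RO 0 (ram_init n M x) t mem
                    & read mem 0 = Some (f RO x)].

(** * Massively parallel computation with oracle access *)

(* A local computation with adaptive oracle queries, returning an [A]. *)
Inductive query_alg (n : nat) (A : Type) :=
| Ret (a : A)
| Ask (w : word n) (k : word n -> query_alg n A).

Fixpoint query_result n A (RO : oracle n) (t : query_alg n A) : A :=
  match t with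
  | Ret a => a
  | Ask w k => query_result RO (k (RO w))
  end.

Fixpoint query_count n A (RO : oracle n) (t : query_alg n A) : nat :=
  match t with
  | Ret _ => 0
  | Ask w k => (query_count RO (k (RO w))).+1
  end.

(* What a machine produces in one round: a message for each machine, and a
   contribution to the n-bit output, as a set of pairs (position, bit). *)
Record round_result (n m : nat) := RoundResult {
  messages : 'I_m -> seq bool;
  emitted : {set 'I_n * bool}
}.

(* The local computation may depend on the round, the machine, the shared
   random tape of L bits and the local memory, and is otherwise arbitrary. *)
Definition mpc_alg (n m L : nat) :=
  nat -> 'I_m -> L.-tuple bool -> seq bool -> query_alg n (round_result n m).

(* [split j] is the machine that initially holds the j-th input bit. *)
Definition input_share N m (split : 'I_N -> 'I_m) (x : N.-tuple bool) (i : 'I_m) :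
    seq bool :=
  [seq tnth x j | j <- enum 'I_N & split j == i].

Section Execution.
Variables (n N m L : nat) (A : mpc_alg n m L) (split : 'I_N -> 'I_m).
Variables (RO : oracle n) (rho : L.-tuple bool) (x : N.-tuple bool).

(* The local memories at the beginning of round k.  Messages are concatenated
   in the order of their senders, so that a memory carries no information
   besides the bits received. *)
Fixpoint mpc_memory (k : nat) : 'I_m -> seq bool :=
  match k with
  | 0 => input_share split x
  | k'.+1 => fun i =>
      flatten [seq messages (query_result RO (A k' j rho (mpc_memory k' j))) i
              | j <- enum 'I_m]
  end.

Definition mpc_local (k : nat) (i : 'I_m) : query_alg n (round_result n m) :=
  A k i rho (mpc_memory k i).

Definition mpc_output (rounds : nat) : {set 'I_n * bool} :=
  \bigcup_(k < rounds) \bigcup_(i < m) emitted (query_result RO (mpc_local k i)).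

End Execution.

(* Local memories never exceed s bits, and no machine makes more than q queries
   in a round. *)
Definition mpc_respects n N m L (A : mpc_alg n m L) (split : 'I_N -> 'I_m)
    (rounds s q : nat) : Prop :=
  (forall i, #|[set j | split j == i]| <= s) /\
  forall (RO : oracle n) (rho : L.-tuple bool) (x : N.-tuple bool) (k : nat) (i : 'I_m),
    k < rounds ->
    size (mpc_memory A split RO rho x k i) <= s /\
    query_count RO (mpc_local A split RO rho x k i) <= q.

Definition graph_of n (y : n.-tuple bool) : {set 'I_n * bool} :=
  [set (i, tnth y i) | i : 'I_n].

Definition mpc_success (R : realType) n N m L (A : mpc_alg n m L)
    (split : 'I_N -> 'I_m) (rounds : nat) (f : oracle_function n N) : R :=
  pr R (fun w : N.-tuple bool * L.-tuple bool * oracle n =>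
    let: (x, rho, RO) := w in
    mpc_output A split RO rho x rounds == graph_of (f RO x)).

Definition mpc_computes_on_average (R : realType) n N m L (A : mpc_alg n m L)
    (split : 'I_N -> 'I_m) (rounds : nat) (f : oracle_function n N) : Prop :=
  (1 / 3 <= mpc_success R A split rounds f)%R.

(* Main.v *)
Require Import Defs.
From HB Require Import structures.
From mathcomp Require Import all_boot all_order all_algebra.
From mathcomp Require Import reals exp zify.

Set Implicit Arguments.
Unset Strict Implicit.
Unset Printing Implicit Defensive.

Import Order.TTheory GRing.Theory Num.Theory.

(** Cut the input into [v = S %/ n] blocks and iterate T times
    [r_(j+1) = RO(j, x_(j mod v), r_j)], where each of the three fields takes
    about a third of the n bits of the query; the output is [r_T].

    Fix the oracle.  A machine that asks, in one round, for [h] consecutive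
    points of this chain reveals [h] blocks, about [h n / 3] bits of the input,
    through its [s] bits of memory and the positions of [h] queries; with
    [h = 10 s / n + 1] few inputs allow this, by counting.  Fix the input
    instead.  Since the counter makes the points of the chain distinct, the
    answer at point [j] can be resampled without changing point [j] itself or
    anything asked before it, so asking for point [j + 1] first amounts to
    guessing n/3 random bits, and giving the output without asking for the last
    point amounts to guessing n bits.  Outside these rare events every round
    moves the frontier of the chain by at most [h], so that at least T / h
    rounds are needed. *)

Local Open Scope nat_scope.

(** * Counting tools, with probabilities as cross-multiplied cardinalities *)

Lemma union_bound (I T : finType) (D : {pred I}) (F : I -> {set T})
    (E : {set T}) c d :
    (forall i, i \in D -> #|F i| * d <= c) ->
    (forall x, x \in E -> exists2 i, i \in D & x \in F i) ->
  #|E| * d <= #|D| * c.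
Proof.
move=> Fle EF.
have /subset_leq_card cardE : E \subset \bigcup_(i in D) F i.
  by apply/subsetP=> x /EF[i iD xF]; apply/bigcupP; exists i.
have cardU : #|\bigcup_(i in D) F i| <= \sum_(i in D) #|F i|.
  elim/big_rec2: _ => [|i k A _ leAk]; first by rewrite cards0.
  by rewrite (leq_trans (leq_card_setU _ _)) ?leq_add2l.
apply: leq_trans (leq_mul (leq_trans cardE cardU) (leqnn d)) _.
by rewrite big_distrl -sum_nat_const leq_sum.
Qed.

(** Overwriting the bits at [pos] by an arbitrary function is injective: the new bits give the
    function back, and the lost ones were prescribed by [b]. *)
Lemma card_bits_fixed (I : finType) N (pos : I -> 'I_N) (b : I -> bool) :
    injective pos ->
  #|[set x : N.-tuple bool | [forall i, tnth x (pos i) == b i]]| * 2 ^ #|I|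
    <= 2 ^ N.
Proof.
move=> pos_inj; set E := [set x | _].
have -> : 2 ^ #|I| = #|[set: {ffun I -> bool}]|.
  by rewrite cardsT card_ffun card_bool.
have -> : 2 ^ N = #|{: N.-tuple bool}| by rewrite card_tuple card_bool.
pose put (p : N.-tuple bool * {ffun I -> bool}) : N.-tuple bool :=
  [tuple if [pick i | pos i == j] is Some i then p.2 i else tnth p.1 j | j < N].
have putE x c i : tnth (put (x, c)) (pos i) = c i.
  rewrite tnth_mktuple; case: pickP => [i' /eqP/pos_inj -> //|/(_ i)].
  by rewrite eqxx.
rewrite -cardsX; apply: (@leq_card_in _ _ put) => -[x c] [x' c'].
rewrite !inE !andbT => /forallP/= xE /forallP/= x'E put_eq.
have eq_c : c = c' by apply/ffunP=> i; rewrite -(putE x c) put_eq putE.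
congr (_, _) => //; apply/eq_from_tnth=> j.
have [[i /eqP<-]|no_i] := altP (@existsP _ (fun i => pos i == j)).
  by rewrite (eqP (xE i)) (eqP (x'E i)).
have := congr1 (fun t : N.-tuple bool => tnth t j) put_eq.
rewrite !tnth_mktuple; case: pickP => // i ij _.
by case/existsP: no_i; exists i.
Qed.

Definition update (A B : finType) (g : {ffun A -> B}) a y : {ffun A -> B} :=
  [ffun z => if z == a then y else g z].

Lemma update_off (A B : finType) (g : {ffun A -> B}) a y z :
  z != a -> g z = update g a y z.
Proof. by rewrite ffunE; case: eqP. Qed.

(* The value of [g] at [w g] can be resampled without changing [w g] or [P g]:
   swapping it with a fresh value is an injection. *)
Lemma card_resample (A B : finType) (w : {ffun A -> B} -> A)
    (P : {ffun A -> B} -> pred B) b :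
    (forall g y, w (update g (w g) y) = w g) ->
    (forall g y, P (update g (w g) y) = P g) ->
    (forall g, #|P g| <= b) ->
  #|[set g | P g (g (w g))]| * #|B| <= #|{ffun A -> B}| * b.
Proof.
move=> wE PE Pb; set E := [set g | _].
pose swap (p : {ffun A -> B} * B) := (update p.1 (w p.1) p.2, p.1 (w p.1)).
rewrite -[#|B|]cardsT -cardsX -(card_in_imset (f := swap)); last first.
  move=> [g y] [g' y'] _ _ [eq_up eq_val].
  have eq_w : w g = w g' by rewrite -(wE g y) -(wE g' y') eq_up.
  congr (_, _); last first.
    by have := congr1 (fun g : {ffun A -> B} => g (w g)) eq_up;
       rewrite !ffunE !wE !eqxx.
  apply/ffunP=> z; have := congr1 (fun g : {ffun A -> B} => g z) eq_up.
  by rewrite !ffunE -eq_w; case: eqP => // ->; rewrite eq_val eq_w.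
(* Swapped pairs land in [Q]: the stored old value satisfies [P g], and [P] does not see the
   update. *)
pose Q := [set p : {ffun A -> B} * B | P p.1 p.2].
apply: (@leq_trans #|Q|).
  apply: subset_leq_card; apply/subsetP=> p /imsetP[[g y]].
  by rewrite !inE andbT => Pg ->; rewrite /= PE.
rewrite -sum1_card (eq_bigl (fun p : {ffun A -> B} * B => P p.1 p.2)); last first.
  by move=> p; rewrite inE.
rewrite -(pair_big_dep xpredT P (fun _ _ => 1)) /= -sum_nat_const.
by apply: leq_sum => g _; rewrite sum1_card.
Qed.

Lemma nat_of_word_of_nat n k : k < 2 ^ n -> nat_of_word (word_of_nat n k) = k.
Proof.
move=> kn; rewrite /nat_of_word -[RHS](modn_small kn).
under eq_bigr => i _ do rewrite tnth_mktuple.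
elim: n {kn} => [|n IHn]; first by rewrite big_ord0 modn1.
rewrite big_ord_recr /= IHn {IHn}.
have kE : k = (k %/ 2 ^ n)./2 * 2 ^ n.+1 + (odd (k %/ 2 ^ n) * 2 ^ n + k %% 2 ^ n).
  rewrite addnA expnS mulnA muln2 -mulnDl addnC [_.*2 + _]addnC.
  by rewrite odd_double_half addnC -divn_eq.
rewrite [in RHS]kE modnMDl [RHS]modn_small; first by rewrite addnC.
have := ltn_pmod k (expn_gt0 2 n : 0 < 2 ^ n).
by rewrite expnS; case: (odd _) => /=; lia.
Qed.

(** Lets [Or] of a cell with itself act as a copy instruction. *)
Lemma bitwise_orbb n (w : word n) : bitwise orb w w = w.
Proof. by apply: eq_from_tnth => i; rewrite tnth_mktuple orbb. Qed.

Lemma graph_of_inj n : injective (@graph_of n).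
Proof.
move=> y y' eq_g; apply: eq_from_tnth => i.
have : (i, tnth y i) \in graph_of y' by rewrite -eq_g; apply/imsetP; exists i.
by case/imsetP=> i' _ [<-].
Qed.

Lemma onth_mkseq (A : Type) (g : nat -> A) k i : i < k ->
  onth (mkseq g k) i = Some (g i).
Proof.
suff onthE j : i < k -> onth [seq g l | l <- iota j k] i = Some (g (j + i)).
  exact: onthE.
by elim: k i j => // k IHk [|i] j /= ?; rewrite ?addn0 // IHk // addnS.
Qed.

(** * Query sequences of a local computation *)

Section Queries.
Variables (n : nat) (A : Type).
Implicit Types (RO : oracle n) (t : query_alg n A).

Fixpoint queries RO t : seq (word n) :=
  if t is Ask w k then w :: queries RO (k (RO w)) else [::].

Lemma size_queries RO t : size (queries RO t) = query_count RO t.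
Proof. by elim: t => //= w k IHk; rewrite IHk. Qed.

(** If [w] is never asked, [index] is the length and this is the whole query sequence. *)
Definition queries_before w RO t := take (index w (queries RO t)) (queries RO t).

Lemma eq_queries_before w RO RO' t : (forall z, z != w -> RO z = RO' z) ->
  queries_before w RO t = queries_before w RO' t.
Proof.
rewrite /queries_before => eqRO; elim: t => //= z k IHk.
by have [//|zw] := eqVneq z w; rewrite /= eqRO // IHk.
Qed.

Lemma eq_queries w RO RO' t : (forall z, z != w -> RO z = RO' z) ->
  w \notin queries RO t ->
  queries RO t = queries RO' t /\ query_result RO t = query_result RO' t.
Proof.
move=> eqRO; elim: t => //= z k IHk; rewrite inE eq_sym => /norP[zw].
by rewrite eqRO // => /IHk[-> ->].
Qed.

End Queries.

(** * Executions under two oracles that differ at one point *)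

Section Execution.
Variables (n N m L : nat) (A : mpc_alg n m L) (split : 'I_N -> 'I_m).
Variables (rho : L.-tuple bool) (x : N.-tuple bool).
Implicit Types (RO : oracle n) (w z : word n).

Definition round_queries RO k i := queries RO (mpc_local A split RO rho x k i).

Definition asked_before RO k w :=
  [exists k' : 'I_k, exists i : 'I_m, w \in round_queries RO k' i].

Lemma asked_beforeP RO k w :
  reflect (exists k' i, k' < k /\ w \in round_queries RO k' i)
          (asked_before RO k w).
Proof.
apply: (iffP existsP) => [[k' /existsP[i wq]]|[k' [i [ltk wq]]]].
  by exists k', i.
by exists (Ordinal ltk); apply/existsP; exists i.
Qed.

Lemma asked_before_le RO k k' w :
  k <= k' -> asked_before RO k w -> asked_before RO k' w.
Proof.
move=> lekk' /asked_beforeP[l [i [ltlk wq]]]; apply/asked_beforeP.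
by exists l, i; split=> //; apply: leq_trans lekk'.
Qed.

Section Agree.
Variables (RO RO' : oracle n) (w : word n).
Hypothesis eqRO : forall z, z != w -> RO z = RO' z.

Lemma eq_mpc_memory k : ~~ asked_before RO k w ->
  mpc_memory A split RO rho x k =1 mpc_memory A split RO' rho x k.
Proof.
elim: k => //= k IHk not_asked i; congr flatten; apply: eq_map => j.
rewrite -IHk; last by apply: contra not_asked; apply: asked_before_le.
have [|_ -> //] := eq_queries (t := A k j rho (mpc_memory A split RO rho x k j)) eqRO.
by apply: contra not_asked => wq; apply/asked_beforeP; exists k, j.
Qed.

Lemma eq_mpc_local k i : ~~ asked_before RO k w ->
  mpc_local A split RO rho x k i = mpc_local A split RO' rho x k i.
Proof. by move=> not_asked; rewrite /mpc_local eq_mpc_memory. Qed.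

(** If [RO'] leads to [w] being asked in round [k'], the memories at the start of that round still
    agree; as [RO] does not ask [w] there, the machine's two query sequences coincide. *)
Lemma not_asked_before k : ~~ asked_before RO k w -> ~~ asked_before RO' k w.
Proof.
move=> not_asked; apply/asked_beforeP => -[k' [i [ltk wq]]].
case/asked_beforeP: (not_asked); exists k', i; split=> //.
have not_asked' : ~~ asked_before RO k' w.
  by apply: contra not_asked; apply/asked_before_le/ltnW.
have [//|wq'] := boolP (w \in round_queries RO k' i).
have [eq_q _] := eq_queries eqRO wq'.
by move: wq; rewrite /round_queries -(eq_mpc_local _ not_asked') -eq_q (negbTE wq').
Qed.

Lemma eq_mpc_output k : ~~ asked_before RO k w ->
  mpc_output A split RO rho x k = mpc_output A split RO' rho x k.
Proof.
move=> not_asked; apply: eq_bigr => k' _; apply: eq_bigr => i _.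
have not_asked' : ~~ asked_before RO k' w.
  by apply: contra not_asked; apply/asked_before_le/ltnW.
rewrite -(eq_mpc_local _ not_asked').
have [|_ -> //] := eq_queries (t := mpc_local A split RO rho x k' i) eqRO.
apply: contra not_asked => wq; apply/asked_beforeP.
by exists k', i.
Qed.

End Agree.

Lemma eq_asked_before RO RO' w k : (forall z, z != w -> RO z = RO' z) ->
  asked_before RO k w = asked_before RO' k w.
Proof.
move=> eqRO; have eqRO' z : z != w -> RO' z = RO z by move/eqRO.
by apply/idP/idP; apply: contraTT; apply: not_asked_before.
Qed.

(* What the algorithm can ask without knowing the answer to [w]. *)
Definition early rounds RO w : {set word n} :=
  [set z | [exists k : 'I_rounds, exists i : 'I_m, ~~ asked_before RO k w &&
     (z \in queries_before w RO (mpc_local A split RO rho x k i))]].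

(** This invariance makes it legitimate to resample the answer at [w] in [card_skipping]. *)
Lemma eq_early rounds RO RO' w : (forall z, z != w -> RO z = RO' z) ->
  early rounds RO w = early rounds RO' w.
Proof.
move=> eqRO; apply/setP=> z; rewrite !inE.
apply: eq_existsb => k; apply: eq_existsb => i.
rewrite -(eq_asked_before _ eqRO); case: (boolP (asked_before RO k w)) => //= nw.
by rewrite -(eq_mpc_local eqRO i nw) (eq_queries_before _ eqRO).
Qed.

Lemma card_early rounds q RO w :
    (forall k i, k < rounds -> query_count RO (mpc_local A split RO rho x k i) <= q) ->
  #|early rounds RO w| <= rounds * m * q.
Proof.
move=> leq_q; rewrite -(muln1 #|_|).
have -> : rounds * m = #|{: 'I_rounds * 'I_m}| by rewrite card_prod !card_ord.
apply: (union_bound (D := xpredT) (F := fun ki : 'I_rounds * 'I_m =>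
  [set z in queries_before w RO (mpc_local A split RO rho x ki.1 ki.2)])).
  move=> [k i] _ /=; rewrite muln1 cardsE.
  apply: leq_trans (card_size _) (leq_trans _ (leq_q k i (ltn_ord k))).
  by rewrite -size_queries size_take; case: ltnP => // /ltnW.
by move=> z; rewrite inE => /existsP[k /existsP[i /andP[_ zq]]]; exists (k, i);
   rewrite ?inE.
Qed.

(** Induction on rounds. A machine that asks [v j.+1] in round [k], with [v j] at or beyond the
    frontier [k * h], also asks [v j] in that round, since otherwise [v j.+1] would be early.
    Descending to the frontier, an advance by more than [h] would yield a forbidden run of [h]
    points. *)
Lemma asked_before_frontier rounds RO (v : nat -> word n) h T :
    (forall j, j.+1 < T -> v j.+1 \notin early rounds RO (v j)) ->
    (forall k i p, k < rounds -> p + h <= T ->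
       exists2 t, t < h & v (p + t) \notin round_queries RO k i) ->
  forall k j, k <= rounds -> j < T -> asked_before RO k (v j) -> j < k * h.
Proof.
move=> not_early no_run; elim=> [|k IHk] j le_k ltj /asked_beforeP[k' [i []]] //.
rewrite ltnS leq_eqVlt => /orP[/eqP-> {k'}|ltk' vq]; last first.
  have jk : j < k * h.
    by apply: IHk => //; [apply: ltnW | apply/asked_beforeP; exists k', i].
  by apply: leq_trans jk _; rewrite leq_mul2r leqnSn orbT.
move=> vq; rewrite ltnNge; apply/negP=> le_j.
have down d : k * h <= j - d -> v (j - d) \in round_queries RO k i.
  elim: d => [|d IHd] le_d; first by rewrite subn0.
  have [dj|jd] := ltnP d j; last first.
    by rewrite (_ : j - d.+1 = j - d) ?IHd //; lia.
  have {}IHd : v (j - d.+1).+1 \in round_queries RO k i.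
    by rewrite subnSK // IHd //; lia.
  have /not_early : (j - d.+1).+1 < T by lia.
  apply: contraNT => not_q; rewrite inE; apply/existsP; exists (Ordinal le_k).
  apply/existsP; exists i; apply/andP; split.
    apply/negP=> asked; suff: j - d.+1 < k * h by rewrite ltnNge le_d.
    by apply: IHk asked; lia.
  by rewrite /queries_before memNindex // take_size.
have [] := no_run k i (k * h) le_k; first by lia.
move=> t lt_t /negP; apply.
by have := down (j - (k * h + t)); rewrite subKn; [apply; lia | lia].
Qed.

End Execution.

(** * The iterated function and its nodes *)

Definition field_width n := n %/ 3.
(** The counter also absorbs the remainder of [n] modulo 3, so the three fields fill the word
    exactly. *)
Definition counter_width n := n - (field_width n).*2.

Lemma fields_split n : counter_width n + (field_width n).*2 = n.
Proof. by rewrite /counter_width /field_width; lia. Qed.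

Definition block n (x : seq bool) j : word n :=
  [tuple nth false x (j * n + i) | i < n].

Definition range_mask n lo hi : word n := [tuple lo <= i < hi | i < n].

Section Line.
Variables (n N : nat).
Implicit Types (x : N.-tuple bool) (RO : oracle n) (r w : word n).
Local Notation ck := (counter_width n).
Local Notation u := (field_width n).
Local Notation blocks := (N %/ n).

(* A node packs, from the low bits up, the counter [j], a third of the input
   block [j %% blocks] and a third of the previous answer [r]. *)
Definition node x j r : word n :=
  bitwise orb
    (bitwise orb (bitwise andb (block n x (j %% blocks)) (range_mask n ck (ck + u)))
                 (bitwise andb r (range_mask n (ck + u) n)))
    (word_of_nat n j).

(** The bound on [j] keeps the counter out of the other two fields, which the disjunction would
    otherwise mix with it. *)
Lemma tnth_node x j r (i : 'I_n) : j < 2 ^ ck ->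
  tnth (node x j r) i =
    if i < ck then odd (j %/ 2 ^ i)
    else if i < ck + u then nth false x (j %% blocks * n + i) else tnth r i.
Proof.
move=> ltj; rewrite !tnth_mktuple ltn_ord andbT.
case: (ltnP i ck) => [ltick|leck].
  by rewrite (_ : ck + u <= i = false) ?andbF //; apply/negbTE; rewrite -ltnNge; lia.
rewrite (divn_small (leq_trans ltj _)) ?leq_pexp2l //= orbF.
by case: ltnP; rewrite ?andbT ?andbF ?orbF.
Qed.

Lemma node_inj x x' j j' r r' : j < 2 ^ ck -> j' < 2 ^ ck ->
  node x j r = node x' j' r' -> j = j'.
Proof.
move=> ltj ltj' eq_node; rewrite -(nat_of_word_of_nat ltj) -(nat_of_word_of_nat ltj').
congr nat_of_word; apply: eq_from_tnth => i; rewrite !tnth_mktuple.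
have ltin : i < n by rewrite (leq_trans (ltn_ord i)) ?leq_subr.
have := congr1 (fun w : word n => tnth w (Ordinal ltin)) eq_node.
by rewrite !tnth_node //= ltn_ord.
Qed.

Fixpoint chain RO x j : word n :=
  if j is j'.+1 then RO (node x j' (chain RO x j')) else word_of_nat n 0.

Definition visit RO x j := node x j (chain RO x j).

(** Counters tell nodes apart, so the earlier steps never query the updated point. *)
Lemma chain_update RO x j y i : j < 2 ^ ck -> i <= j ->
  chain (update RO (visit RO x j) y) x i = chain RO x i.
Proof.
move=> ltj; elim: i => //= i IHi ltij; rewrite IHi ?(ltnW ltij) // ffunE.
case: eqP => // /node_inj eq_ij.
by have := ltij; rewrite eq_ij ?ltnn // (ltn_trans ltij).
Qed.

Lemma visit_update RO x j y : j < 2 ^ ck ->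
  visit (update RO (visit RO x j) y) x j = visit RO x j.
Proof. by move=> ltj; rewrite {1}/visit chain_update. Qed.

Lemma card_node_fiber x j w : j < 2 ^ ck ->
  #|[set r | node x j r == w]| * 2 ^ u <= 2 ^ n.
Proof.
move=> ltj.
have ltpos (i : 'I_u) : ck + u + i < n.
  by rewrite -[X in _ < X]fields_split -addnn addnA ltn_add2l.
pose pos (i : 'I_u) : 'I_n := Ordinal (ltpos i).
have -> : 2 ^ u = 2 ^ #|'I_u| by rewrite card_ord.
apply: leq_trans (card_bits_fixed (pos := pos) (tnth w \o pos) _); last first.
  by move=> i i' /(congr1 val)/= /addnI/val_inj.
rewrite leq_mul2r subset_leq_card ?orbT //.
apply/subsetP=> r; rewrite !inE => /eqP <-.
apply/forallP=> i /=; rewrite tnth_node //=.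
by rewrite -addnA ltnNge leq_addr /= ltnNge leq_add2l leq_addr.
Qed.

(** * Rare events: skipping a node, guessing the output, asking a long run *)

Section Machines.
Variables (m L : nat) (A : mpc_alg n m L) (split : 'I_N -> 'I_m).
Variables (rounds s q : nat).
Hypothesis respects : mpc_respects A split rounds s q.

(** Resampling the answer at node [j] moves neither this node nor the early set, while the next node
    carries [u] fresh bits: it hits a given early point at most once in [2 ^ u]. *)
Lemma card_skipping rho x j : j.+1 < 2 ^ ck ->
  #|[set RO | visit RO x j.+1 \in early A split rho x rounds RO (visit RO x j)]|
    * 2 ^ u <= #|{: oracle n}| * (rounds * m * q).
Proof.
move=> ltj; have ltj' := ltnW ltj; set b := rounds * m * q.
have n_u : 2 ^ n = 2 ^ u * 2 ^ (n - u).
  by rewrite -expnD subnKC // leq_div.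
have := @card_resample (word n) (word n) (fun RO => visit RO x j)
  (fun RO y => node x j.+1 y \in early A split rho x rounds RO (visit RO x j))
  (b * 2 ^ (n - u)).
rewrite [#|{: word n}|]card_tuple card_bool mulnA n_u mulnA leq_mul2r expn_eq0 /=.
apply=> [RO y|RO y|RO]; first exact: visit_update.
  have off z : z != visit RO x j -> RO z = update RO (visit RO x j) y z.
    exact: update_off.
  by rewrite visit_update // -(eq_early A split rho x rounds off).
rewrite -(@leq_pmul2r (2 ^ u)) ?expn_gt0 // -mulnA [2 ^ (n - u) * _]mulnC -n_u.
have le_b : #|early A split rho x rounds RO (visit RO x j)| <= b.
  by apply: card_early => k i ltk; case: respects => _ /(_ RO rho x k i ltk)[].
apply: leq_trans (leq_mul le_b (leqnn _)).
have := @union_bound _ _ (early A split rho x rounds RO (visit RO x j))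
  (fun w => [set r | node x j.+1 r == w])
  [set y | node x j.+1 y \in early A split rho x rounds RO (visit RO x j)]
  (2 ^ n) (2 ^ u).
rewrite cardsE; apply=> [w _|y]; first exact: card_node_fiber.
by rewrite in_set => yE; exists (node x j.+1 y) => //; rewrite in_set.
Qed.

(** As long as node [j] is not asked, the output ignores its answer; by [graph_of_inj] at most one
    resampled answer fits. *)
Lemma card_guessing rho x j : j < 2 ^ ck ->
  #|[set RO | ~~ asked_before A split rho x RO rounds (visit RO x j)
       && (mpc_output A split RO rho x rounds == graph_of (chain RO x j.+1))]|
    * 2 ^ n <= #|{: oracle n}|.
Proof.
move=> ltj.
have := @card_resample (word n) (word n) (fun RO => visit RO x j)
  (fun RO y => ~~ asked_before A split rho x RO rounds (visit RO x j)
       && (mpc_output A split RO rho x rounds == graph_of y)) 1.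
rewrite [#|{: word n}|]card_tuple card_bool muln1; apply=> [RO y|RO y|RO].
- exact: visit_update.
- have off z : z != visit RO x j -> RO z = update RO (visit RO x j) y z.
    exact: update_off.
  rewrite visit_update // -(eq_asked_before A split rho x rounds off).
  case: (boolP (asked_before _ _ _ _ _ _ _)) => //= not_asked.
  by rewrite -(eq_mpc_output off not_asked).
apply/card_le1_eqP => y y' /andP[_ /eqP out_y] /andP[_].
by rewrite out_y => /eqP/graph_of_inj.
Qed.

(* Given the oracle, the [h] blocks are read off the memory, which has at most
   [s] bits, and the positions of the [h] queries. *)
Lemma card_running rho RO k i p h :
    k < rounds -> h <= blocks -> p + h <= 2 ^ ck ->
  #|[set x | [forall t : 'I_h,
       visit RO x (p + t) \in round_queries A split rho x RO k i]]| * 2 ^ (h * u)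
    <= s.+1 * 2 ^ s * q.+1 ^ h * 2 ^ N.
Proof.
move=> ltk leh lep.
(* The advice: the length of the memory, its bits padded to [s], and the index of each of the [h]
   queries. *)
have -> : s.+1 * 2 ^ s * q.+1 ^ h =
    #|{: 'I_s.+1 * s.-tuple bool * {ffun 'I_h -> 'I_q.+1}}|.
  by rewrite !card_prod card_ffun card_tuple !card_ord card_bool.
have -> : h * u = #|{: 'I_h * 'I_u}| by rewrite card_prod !card_ord.
have ltpos (ti : 'I_h * 'I_u) : (p + ti.1) %% blocks * n + (ck + ti.2) < N.
  have := ltn_pmod (p + ti.1) (leq_trans (leq_ltn_trans (leq0n _) (ltn_ord ti.1)) leh).
  have := ltn_ord ti.2; have := fields_split n; have := leq_divM N n.
  set a := _ %% _; set v := N %/ n => lv ck2 lt_i lt_a.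
  apply: leq_trans lv; apply: leq_trans (_ : a.+1 * n <= _); last first.
    by rewrite leq_mul2r lt_a orbT.
  by rewrite mulSn; lia.
pose pos ti : 'I_N := Ordinal (ltpos ti).
have pos_inj : injective pos.
  move=> [t i1] [t' i'] /(congr1 val) /=.
  have lti (l : 'I_u) : ck + l < n.
    by have := ltn_ord l; have := fields_split n; lia.
  have n0 : 0 < n by apply: leq_ltn_trans (lti i1).
  (* Modulo [n] the position gives the bit, and its quotient the block; [h <= blocks] keeps the
     blocks of a run distinct. *)
  move=> eq_pos; have := congr1 (divn^~ n) eq_pos; have := congr1 (modn^~ n) eq_pos.
  rewrite /= !modnMDl !(modn_small (lti _)) !divnMDl // !(divn_small (lti _)) !addn0.
  move=> /addnI/val_inj-> /eqP; rewrite eqn_modDl !modn_small ?(leq_trans _ leh) //.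
  by move=> /eqP/val_inj->.
pose asked (c : 'I_s.+1 * s.-tuple bool * {ffun 'I_h -> 'I_q.+1}) t :=
  nth (word_of_nat n 0) (queries RO (A k i rho (take c.1.1 c.1.2))) (c.2 t).
apply: (union_bound (D := xpredT) (F := fun c => [set x : N.-tuple bool | [forall ti,
  tnth x (pos ti) == nth false (asked c ti.1) (ck + ti.2)]])).
  by move=> c _; apply: card_bits_fixed.
move=> x; rewrite inE => /forallP xq.
set mem := mpc_memory A split RO rho x k i.
have [_ /(_ RO rho x k i ltk)[le_mem le_q]] := respects.
pose pad : s.-tuple bool := [tuple nth false mem l | l < s].
pose idx : {ffun 'I_h -> 'I_q.+1} := [ffun t : 'I_h =>
  inord (index (visit RO x (p + t)) (round_queries A split rho x RO k i))].
exists (inord (size mem), pad, idx) => //; rewrite inE; apply/forallP=> -[t j].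
rewrite /asked /= inordK //.
have -> : take (size mem) pad = mem.
  apply: (@eq_from_nth _ false) => [|l]; first by rewrite size_takel ?size_tuple.
  rewrite size_takel ?size_tuple // => ltl; rewrite nth_take //.
  by rewrite (nth_mktuple _ _ (Ordinal (leq_trans ltl le_mem))).
have := xq t; rewrite -index_mem => lt_idx.
rewrite ffunE inordK; last first.
  by rewrite ltnS (leq_trans (ltnW lt_idx)) // size_queries.
rewrite -[queries RO _]/(round_queries A split rho x RO k i) nth_index ?xq //.
have ltj : ck + j < n by have := ltn_ord j; have := fields_split n; lia.
rewrite -[ck + j]/(val (Ordinal ltj)) -tnth_nth tnth_node ?(leq_trans _ lep) ?ltn_add2l //=.
by rewrite ltnNge leq_addr /= ltn_ord (tnth_nth false).
Qed.

End Machines.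
End Line.

(** * The RAM program and its running time *)

Definition line n N T : oracle_function n N := fun RO x => chain RO x T.

(* Working cells, after the blocks: pointer [j %% blocks], counter [j], last
   answer, the two masks, the constants 1, [T] and [blocks], the next query. *)
Definition line_program n N T : ram_program n :=
  let v := N %/ n in
  let ck := counter_width n in let u := field_width n in
  [:: Const (v + 0) (word_of_nat n 0); Const (v + 1) (word_of_nat n 0);
      Const (v + 2) (word_of_nat n 0);
      Const (v + 3) (range_mask n ck (ck + u)); Const (v + 4) (range_mask n (ck + u) n);
      Const (v + 5) (word_of_nat n 1); Const (v + 6) (word_of_nat n T);
      Const (v + 7) (word_of_nat n v);
      LoadInd (v + 8) (v + 0);
      Binop And (v + 8) (v + 8) (v + 3);
      Binop And (v + 2) (v + 2) (v + 4);
      Binop Or (v + 8) (v + 8) (v + 2);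
      Binop Or (v + 8) (v + 8) (v + 1);
      Query (v + 2) (v + 8);
      Binop Add (v + 1) (v + 1) (v + 5);
      Binop Add (v + 0) (v + 0) (v + 5);
      JumpLt (v + 0) (v + 7) 18;
      Const (v + 0) (word_of_nat n 0);
      JumpLt (v + 1) (v + 6) 8;
      Binop Or 0 (v + 2) (v + 2);
      Halt].

Section Ram.
Variables (n : nat) (P : ram_program n) (RO : oracle n).
Implicit Types (mem I W : memory n) (out w : word n).

Definition halts pc mem time out :=
  exists t mem', [/\ t <= time, ram_run P RO pc mem t mem' & read mem' 0 = Some out].

Lemma halts_le t t' pc mem out :
  halts pc mem t out -> t <= t' -> halts pc mem t' out.
Proof.
by move=> [t0 [mem' [le run out_eq]]] le'; exists t0, mem'; rewrite (leq_trans le).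
Qed.

Lemma halts_halt pc mem out :
  onth P pc = Some Halt -> read mem 0 = Some out -> halts pc mem 1 out.
Proof. by move=> Ppc out_eq; exists 1, mem; split=> //; apply: ram_run_halt. Qed.

Lemma halts_step c pc mem i pc' mem' t out :
  onth P pc = Some i -> ram_step RO i pc mem = Some (pc', mem') ->
  instr_cost i = c -> halts pc' mem' t out -> halts pc mem (c + t) out.
Proof.
move=> Ppc step <- [t0 [mem'' [le run out_eq]]]; exists (instr_cost i + t0), mem''.
by split=> //; [rewrite leq_add2l | apply: ram_run_step step run].
Qed.

Lemma read_input I W v a : size I = v -> a < v -> read (I ++ W) a = onth I a.
Proof. by move=> <-; rewrite /read; elim: I a => [|w I IHI] [|a] //= /IHI. Qed.

Lemma read_work I W v a : size I = v -> read (I ++ W) (v + a) = onth W a.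
Proof. by move=> <-; rewrite /read; elim: I. Qed.

Lemma write_work I W v a w : size I = v -> a < size W ->
  write (I ++ W) (v + a) w = Some (I ++ set_nth w W a w).
Proof.
move=> <- lt_a; rewrite /write size_cat ltn_add2l lt_a; congr Some.
by elim: I => //= w' I ->.
Qed.

End Ram.

Section LineProgram.
Variables (n N T : nat).
Hypotheses (n_gt0 : 0 < n) (le_nN : n <= N) (lt_N : N < 2 ^ n) (lt_T : T < 2 ^ n).
Variables (RO : oracle n) (x : N.-tuple bool).
Local Notation v := (N %/ n).
Local Notation ck := (counter_width n).
Local Notation u := (field_width n).
Local Notation I := (mkseq (block n x) v).
Local Notation halts := (halts (line_program n N T) RO).

Let v_gt0 : 0 < v. Proof. by rewrite divn_gt0. Qed.
Let lt_v : v < 2 ^ n. Proof. exact: leq_ltn_trans (leq_div _ _) lt_N. Qed.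
Let sizeI : size I = v. Proof. by rewrite size_mkseq. Qed.

(** [tmp] is arbitrary, because an iteration overwrites the query cell before reading it. *)
Definition work j r tmp : memory n :=
  [:: word_of_nat n (j %% v); word_of_nat n j; r; range_mask n ck (ck + u);
      range_mask n (ck + u) n; word_of_nat n 1; word_of_nat n T; word_of_nat n v; tmp].

Ltac step :=
  apply: halts_step; [reflexivity
    | rewrite /= ?(read_work _ _ sizeI) /= ?(write_work _ sizeI) //=; reflexivity
    | reflexivity | rewrite ?(write_work _ sizeI) //=].

Lemma halts_iteration j t tmp out : j < T ->
    (forall tmp', halts 18 (I ++ work j.+1 (chain RO x j.+1) tmp') t out) ->
  halts 8 (I ++ work j (chain RO x j) tmp) (n + 9 + t) out.
Proof.
move=> lt_jT next; have lt_jv : j %% v < v by apply: ltn_pmod.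
have lt1 : 1 < 2 ^ n by rewrite -{1}(expn0 2) ltn_exp2l.
(* One query, eight unit steps, and a ninth for the pointer reset, which runs only when the pointer
   wraps around. *)
apply: (@halts_le _ _ _ (1 + (1 + (1 + (1 + (1 + (n + (1 + (1 + (1 + (1 + t)))))))))));
  last by lia.
apply: halts_step; [reflexivity | | reflexivity |].
  rewrite /= (read_work _ _ sizeI) /= nat_of_word_of_nat; last exact: ltn_trans lt_v.
  by rewrite (read_input _ sizeI) // onth_mkseq //= (write_work _ sizeI).
rewrite /=; do 7 step.
rewrite !nat_of_word_of_nat ?addn1 //; try exact: ltn_trans lt_T; try exact: ltn_trans lt_v.
apply: halts_step; [reflexivity | | reflexivity |].
  by rewrite /= !(read_work _ _ sizeI) /= !nat_of_word_of_nat //; apply: leq_ltn_trans lt_v.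
case: ltnP => [lt_Sv|ge_Sv].
  apply: (@halts_le _ _ _ t); last exact: leq_addl.
  have <- : j.+1 %% v = (j %% v).+1 by rewrite -addn1 -modnDml addn1 modn_small.
  exact: next.
have modE : j.+1 %% v = 0.
  by rewrite -addn1 -modnDml addn1 (_ : (j %% v).+1 = v) ?modnn //; lia.
by step; move: next; rewrite /work modE; apply.
Qed.

(** Each remaining iteration costs [n + 9] plus the loop test; the final [2] pays for the copy to
    cell 0 and for [Halt]. *)
Lemma halts_loop d j tmp : j + d.+1 = T ->
  halts 8 (I ++ work j (chain RO x j) tmp) (d.+1 * (n + 10) + 2) (chain RO x T).
Proof.
elim: d j tmp => [|d IHd] j tmp jT.
  apply: halts_le (halts_iteration _ _ _) _; first by lia.
    move=> tmp'; apply: (halts_step (c := 1)); [reflexivity | | reflexivity |].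
      by rewrite /= !(read_work _ _ sizeI) /= !nat_of_word_of_nat //; lia.
    rewrite ifF; last by lia.
    rewrite -jT addn1; apply: (halts_step (c := 1)); [reflexivity | | reflexivity |].
      rewrite /= !(read_work _ _ sizeI) /= /write size_cat sizeI ltn_addr //.
    by apply: halts_halt => //; case: (I ++ _) => [|? ?]; rewrite /= bitwise_orbb.
  by lia.
apply: halts_le (halts_iteration _ _ _) _; first by lia.
  move=> tmp'; apply: (halts_step (c := 1)); [reflexivity | | reflexivity |].
    by rewrite /= !(read_work _ _ sizeI) /= !nat_of_word_of_nat //; lia.
  rewrite ifT; last by lia.
  by apply: IHd; lia.
by lia.
Qed.

Lemma halts_line : 0 < T ->
  halts 0 (ram_init n (v + 9) x) (T * (n + 10) + 10) (chain RO x T).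
Proof.
move=> T_gt0; have -> : ram_init n (v + 9) x =
    I ++ [seq block n x j | j <- iota v 9] by rewrite /ram_init /mkseq iotaD map_cat.
rewrite /=.
apply: (@halts_le _ _ _ (1 + (1 + (1 + (1 + (1 + (1 + (1 + (1 + (T * (n + 10) + 2))))))))));
  last by lia.
do 8 step.
have := halts_loop (d := T.-1) (j := 0) (block n x v.+4.+4).
by rewrite prednK // /work mod0n; apply.
Qed.

End LineProgram.

Lemma line_ram n N T : 0 < n -> n <= N -> N < 2 ^ n -> T < 2 ^ n -> 0 < T ->
  ram_computes (line_program n N T) (N %/ n + 9) (21 * (T * n)) (@line n N T).
Proof.
move=> n_gt0 le_nN lt_N lt_T T_gt0; split=> [|RO x].
  rewrite mulnDl {1}(divn_eq N n) leq_add2l ltnW //.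
  by rewrite (leq_trans (ltn_pmod _ n_gt0)) // leq_pmull.
have [t [mem [le run out]]] := halts_line n_gt0 le_nN lt_N lt_T RO x T_gt0.
exists t, mem; split=> //; apply: leq_trans le _.
have : T <= T * n by rewrite leq_pmulr.
by rewrite mulnDr; lia.
Qed.

Lemma leq_ratio a b c d K : 0 < b -> d * K <= b -> a * b <= K * c -> a * d <= c.
Proof.
move=> b_gt0 le_b le_ab; have [K0|K_gt0] := posnP K.
  by move: le_ab; rewrite K0 mul0n leqn0 muln_eq0 (gtn_eqF b_gt0) orbF => /eqP->.
rewrite -(leq_pmul2l K_gt0); apply: leq_trans le_ab.
by rewrite mulnCA leq_mul2l mulnC le_b orbT.
Qed.

(** * Success forces a rare event *)

Section Hardness.
Variables (n N T m L : nat) (A : mpc_alg n m L) (split : 'I_N -> 'I_m).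
Variables (rounds s q h : nat).
Hypothesis respects : mpc_respects A split rounds s q.
Hypotheses (T_gt0 : 0 < T) (h_gt0 : 0 < h) (le_h : h <= N %/ n).
Hypotheses (lt_Th : T + h <= 2 ^ counter_width n) (few_rounds : rounds * h < T).
Local Notation u := (field_width n).

Definition running (rho : L.-tuple bool) (RO : oracle n) : {set N.-tuple bool} :=
  [set x | [exists kip : 'I_rounds * 'I_m * 'I_T, [forall t : 'I_h,
     visit RO x (kip.2 + t) \in round_queries A split rho x RO kip.1.1 kip.1.2]]].

Definition skipping (rho : L.-tuple bool) (x : N.-tuple bool) : {set oracle n} :=
  [set RO | [exists j : 'I_T.-1,
     visit RO x j.+1 \in early A split rho x rounds RO (visit RO x j)]].

Definition guessing (rho : L.-tuple bool) (x : N.-tuple bool) : {set oracle n} :=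
  [set RO | ~~ asked_before A split rho x RO rounds (visit RO x T.-1)
    && (mpc_output A split RO rho x rounds == graph_of (chain RO x T.-1.+1))].

Lemma running_rare rho RO :
    10 * (rounds * m * T * (s.+1 * 2 ^ s * q.+1 ^ h)) <= 2 ^ (h * u) ->
  #|running rho RO| * 10 <= 2 ^ N.
Proof.
move=> small; apply: leq_ratio small _; first by rewrite expn_gt0.
rewrite -mulnA.
have -> : rounds * m * T = #|{: 'I_rounds * 'I_m * 'I_T}| by rewrite !card_prod !card_ord.
apply: (union_bound (D := xpredT) (F := fun kip : 'I_rounds * 'I_m * 'I_T =>
  [set x | [forall t : 'I_h, visit RO x (kip.2 + t) \in
              round_queries A split rho x RO kip.1.1 kip.1.2]])).
  move=> [[k i] p] _ /=; apply: (card_running respects) => //.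
  (* Runs that start near the end may pass [T]; [lt_Th] leaves their counters in range. *)
  by apply: leq_trans lt_Th; rewrite leq_add2r ltnW.
by move=> x; rewrite inE => /existsP[kip run]; exists kip; rewrite ?inE.
Qed.

Lemma skipping_rare rho x : 10 * (T * (rounds * m * q)) <= 2 ^ u ->
  #|skipping rho x| * 10 <= #|{: oracle n}|.
Proof.
move=> small; apply: leq_ratio small _; first by rewrite expn_gt0.
apply: (@leq_trans (T.-1 * (rounds * m * q * #|{: oracle n}|))); last first.
  by rewrite mulnA leq_mul2r leq_mul2r leq_pred !orbT.
rewrite -{1}(card_ord T.-1).
apply: (union_bound (D := xpredT) (F := fun j : 'I_T.-1 => [set RO |
  visit RO x j.+1 \in early A split rho x rounds RO (visit RO x j)])).
  move=> j _; rewrite [X in _ <= X]mulnC; apply: (card_skipping respects).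
  by have := ltn_ord j; lia.
by move=> RO; rewrite inE => /existsP[j skip]; exists j; rewrite // in_set.
Qed.

Lemma guessing_rare rho x : 10 <= 2 ^ n ->
  #|guessing rho x| * 10 <= #|{: oracle n}|.
Proof.
move=> small; have ltT : T.-1 < 2 ^ counter_width n by lia.
apply: leq_trans (card_guessing A split rounds rho x ltT).
by rewrite leq_mul2l small orbT.
Qed.

Definition successes : {set N.-tuple bool * L.-tuple bool * oracle n} :=
  [set w | mpc_output A split w.2 w.1.2 w.1.1 rounds == graph_of (line T w.2 w.1.1)].

(** Outside the three events the last node has been asked, so the frontier bound gives
    [T.-1 < rounds * h], against [few_rounds]. *)
Lemma success_cases x rho RO : (x, rho, RO) \in successes ->
  [|| x \in running rho RO, RO \in skipping rho x | RO \in guessing rho x].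
Proof.
rewrite inE /= /line => success; apply: contraT => /norP[not_run /norP[not_skip not_guess]].
have asked : asked_before A split rho x RO rounds (visit RO x T.-1).
  by apply: contraNT not_guess => not_asked; rewrite inE not_asked prednK.
have := asked_before_frontier (T := T) (h := h) _ _ (leqnn rounds) _ asked.
rewrite ltn_predL T_gt0 => frontier.
suff: T.-1 < rounds * h by lia.
apply: frontier => // [j ltj|k i p ltk le_p].
  apply: contra not_skip => skip; rewrite inE; apply/existsP.
  have ltj' : j < T.-1 by lia.
  by exists (Ordinal ltj').
have ltp : p < T by lia.
move: not_run; rewrite inE => /existsPn/(_ (Ordinal ltk, i, Ordinal ltp)).
by case/forallPn=> t not_q; exists t.
Qed.

(** Each event has density at most 1/10 among all triples, and 3/10 is less than 1/3. *)
Lemma success_rare :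
    10 * (rounds * m * T * (s.+1 * 2 ^ s * q.+1 ^ h)) <= 2 ^ (h * u) ->
    10 * (T * (rounds * m * q)) <= 2 ^ u -> 10 <= 2 ^ n ->
  3 * #|successes| < #|{: N.-tuple bool * L.-tuple bool * oracle n}|.
Proof.
move=> small1 small2 small3; set W := #|_ : predArgType|.
pose E1 := [set w : N.-tuple bool * L.-tuple bool * oracle n | w.1.1 \in running w.1.2 w.2].
pose E2 := [set w : N.-tuple bool * L.-tuple bool * oracle n | w.2 \in skipping w.1.2 w.1.1].
pose E3 := [set w : N.-tuple bool * L.-tuple bool * oracle n | w.2 \in guessing w.1.2 w.1.1].
have sub : successes \subset E1 :|: (E2 :|: E3).
  by apply/subsetP=> -[[x rho] RO] /success_cases; rewrite in_setU in_setU !in_set.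
have oracle_bound (F : L.-tuple bool -> N.-tuple bool -> {set oracle n}) :
    (forall rho x, #|F rho x| * 10 <= #|{: oracle n}|) ->
    #|[set w : N.-tuple bool * L.-tuple bool * oracle n | w.2 \in F w.1.2 w.1.1]| * 10 <= W.
  move=> rareF; rewrite /W card_prod.
  apply: (union_bound (D := xpredT) (F := fun xr : N.-tuple bool * L.-tuple bool =>
    [set (xr, RO) | RO in F xr.2 xr.1])) => [xr _|[xr RO]].
    by apply: leq_trans (rareF xr.2 xr.1); rewrite leq_mul2r leq_imset_card orbT.
  by rewrite inE => FRO; exists xr => //; apply/imsetP; exists RO.
have E1_le : #|E1| * 10 <= W.
  have -> : W = #|{: L.-tuple bool * oracle n}| * 2 ^ N.
    by rewrite /W !card_prod !card_tuple card_bool -mulnA mulnC.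
  apply: (union_bound (D := xpredT) (F := fun rO : L.-tuple bool * oracle n =>
    [set (x, rO.1, rO.2) | x in running rO.1 rO.2])) => [rO _|[[x rho] RO]].
    apply: leq_trans (running_rare rO.1 rO.2 small1).
    by rewrite leq_mul2r leq_imset_card orbT.
  by rewrite inE => run; exists (rho, RO) => //; apply/imsetP; exists x.
have E2_le : #|E2| * 10 <= W by apply: oracle_bound => rho x; apply: skipping_rare.
have E3_le : #|E3| * 10 <= W by apply: oracle_bound => rho x; apply: guessing_rare.
have W_gt0 : 0 < W.
  by rewrite /W !card_prod !card_tuple card_ffun !card_tuple card_bool !muln_gt0 !expn_gt0.
have := leq_trans (subset_leq_card sub) (leq_card_setU E1 (E2 :|: E3)).
move/leq_trans => /(_ (#|E1| + (#|E2| + #|E3|))); rewrite leq_add2l leq_card_setU.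
move: E1_le E2_le E3_le => + + + /(_ isT).
by move: #|successes| #|E1| #|E2| #|E3| => e e1 e2 e3; lia.
Qed.

End Hardness.

(** * Choice of parameters *)

Lemma hardness_exponents n e s h : 1000 <= n -> e = (n %/ 100).+1 -> 0 < h ->
    10 * s < h * n ->
  4 + 4 * e + s + e * h <= h * field_width n.
Proof.
rewrite /field_width => n_ge e_def h_gt0 lt_s.
(* Since [10 * s < h * n], ten times the goal's left side is at most this; with [e] near [n / 100]
   it compares about [3 * n / 2] with [10 * n / 3]. *)
have : h * (n + 40 + 50 * e) <= h * (10 * (n %/ 3)).
  by rewrite leq_mul2l; apply/orP; right; lia.
have : h * 1 <= h * e by rewrite leq_mul2l e_def orbT.
nia.
Qed.

Lemma few_rounds_fail n e N T m L (A : mpc_alg n m L) (split : 'I_N -> 'I_m)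
    rounds s q :
    1000 <= n -> e = (n %/ 100).+1 -> n <= N -> N <= T ->
    T < 2 ^ e -> m < 2 ^ e -> q < 2 ^ e -> 20 * s <= N -> 0 < s ->
    mpc_respects A split rounds s q -> rounds * (11 * s) < T ->
  3 * #|successes T A split rounds| < #|{: N.-tuple bool * L.-tuple bool * oracle n}|.
Proof.
move=> n_ge e_def le_nN le_NT lt_T lt_m lt_q le_s s_gt0 respects few.
have n_gt0 : 0 < n by lia.
(* The least [h] with [10 * s < h * n]: the bits revealed by a run then outweigh the memory and the
   query positions. *)
pose h := (10 * s) %/ n + 1.
have h_gt0 : 0 < h by rewrite /h addn1.
have lt_sh : 10 * s < h * n by rewrite /h addn1 ltn_ceil.
have le_h : h <= N %/ n.
  have [lt_sn|le_ns] := ltnP (10 * s) n.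
    by rewrite /h (divn_small lt_sn) divn_gt0.
  (* Here [10 * s + n <= 20 * s <= N], which is where the ratio 20 comes from. *)
  have -> : h = (10 * s + n) %/ n by rewrite divnDr ?dvdnn // divnn n_gt0.
  by apply: leq_div2r; lia.
(* Uses [0 < s]; this crude bound produces the constant 1/11 of the theorem. *)
have le_h11 : h <= 11 * s by rewrite /h; have := leq_div (10 * s) n; lia.
have le_hT : h <= T.
  exact: leq_trans le_h (leq_trans (leq_div _ _) le_NT).
have few_h : rounds * h < T by apply: leq_ltn_trans few; rewrite leq_mul2l le_h11 orbT.
have le_rounds : rounds <= 2 ^ e.
  apply: ltnW; apply: leq_ltn_trans lt_T; apply: leq_trans (ltnW few_h).
  by rewrite leq_pmulr.
have pow2 a b : a <= b -> 2 ^ a <= 2 ^ b by move=> ?; rewrite leq_pexp2l.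
have le10 : 10 <= 2 ^ 4 by [].
apply: (success_rare respects _ h_gt0 le_h _ few_h).
- by lia.
- apply: leq_trans (_ : 2 ^ e.+1 <= _); first by rewrite expnS; lia.
  by apply: pow2; rewrite /counter_width /field_width; lia.
- apply: leq_trans (pow2 _ _ (hardness_exponents n_ge e_def h_gt0 lt_sh)).
  (* The factors bound, in order, 10, [rounds], [m], [T], [s.+1], [2 ^ s] and [q.+1 ^ h]. *)
  have -> : 2 ^ (4 + 4 * e + s + e * h) =
      2 ^ 4 * (2 ^ e * 2 ^ e * 2 ^ e * (2 ^ e * 2 ^ s * (2 ^ e) ^ h)).
    by rewrite -expnM -!expnD; congr (2 ^ _); lia.
  have lt_s : s.+1 <= 2 ^ e by lia.
  by rewrite !leq_mul ?leq_exp2r //; apply: ltnW.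
- apply: leq_trans (_ : 2 ^ (4 + (e + (e + e + e))) <= _); last first.
    by apply: pow2; rewrite /field_width; lia.
  by rewrite !expnD !leq_mul //; apply: ltnW.
by apply: leq_trans le10 (pow2 _ _ _); lia.
Qed.

(** * Passage to real bounds, and the theorem *)

Local Open Scope ring_scope.

Lemma ltn_exp2_powR (R : realType) (a n : nat) :
  a%:R < (2 : R) `^ (100^-1 * n%:R) -> (a < 2 ^ (n %/ 100).+1)%N.
Proof.
move=> lt_a; rewrite -(ltr_nat R) natrX; apply: lt_le_trans lt_a _.
rewrite -powR_mulrn // ler_powR ?ler1n // mulrC ler_pdivrMr ?ltr0n //.
by rewrite -natrM ler_nat ltnW // ltn_ceil.
Qed.

(** Clearing denominators yields the exact negation of the conclusion of [few_rounds_fail]. *)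
Lemma computes_on_average_card (R : realType) n N T m L (A : mpc_alg n m L)
    (split : 'I_N -> 'I_m) rounds :
    mpc_computes_on_average R A split rounds (@line n N T) ->
  (#|{: N.-tuple bool * L.-tuple bool * oracle n}| <= 3 * #|successes T A split rounds|)%N.
Proof.
rewrite /mpc_computes_on_average /mpc_success /pr.
rewrite (eq_card (B := successes T A split rounds)); last first.
  by move=> [[x rho] RO]; rewrite !inE.
set W := #|_ : predArgType|.
have W_gt0 : (0 < W)%N.
  by rewrite /W !card_prod !card_tuple card_ffun !card_tuple card_bool !muln_gt0 !expn_gt0.
rewrite ler_pdivlMr ?ltr0n // mulrAC mul1r ler_pdivrMr ?ltr0n // -natrM ler_nat.
by rewrite mulnC.
Qed.

Theorem theoremA1 (R : realType) :
  exists c : R, 1 < c /\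
  exists (delta kappa : R) (C n0 : nat), 0 < delta /\ 0 < kappa /\
  forall n : nat, (0 < n)%N -> (n0 <= n)%N ->
  forall S T : nat,
    (n <= S)%N -> S%:R < 2 `^ (delta * n%:R) ->
    (S <= T)%N -> T%:R < 2 `^ (delta * n%:R) ->
  exists f : oracle_function n S,
    (exists (P : ram_program n) (M : nat),
       [/\ (size P <= C)%N, (M * n <= C * S)%N
         & ram_computes P M (C * (T * n)) f]) /\
    forall (m s q : nat),
      m%:R < 2 `^ (delta * n%:R) ->
      s%:R <= S%:R / c ->
      q%:R < 2 `^ (delta * n%:R) ->
    forall (L rounds : nat) (split : 'I_S -> 'I_m) (A : mpc_alg n m L),
      mpc_respects A split rounds s q ->
      mpc_computes_on_average R A split rounds f ->
      kappa * (T%:R / s%:R) <= rounds%:R.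
Proof.
exists 20; split; first by rewrite ltr1n.
(* 21 is both the length of the program and its time factor, and it covers the memory bound
   [S + 9 * n <= 10 * S]. *)
exists 100^-1, 11^-1, 21%N, 1000%N; do 2 (split; first by rewrite invr_gt0 ltr0n).
move=> n n_gt0 n_ge S T le_nS /ltn_exp2_powR lt_S le_ST /ltn_exp2_powR lt_T.
have le_pow : (2 ^ (n %/ 100).+1 <= 2 ^ n)%N by rewrite leq_pexp2l //; lia.
exists (@line n S T); split.
  exists (line_program n S T), (S %/ n + 9)%N; split=> //.
    by rewrite mulnDl; have := leq_divM S n; lia.
  apply: line_ram => //; [exact: leq_trans le_pow | exact: leq_trans le_pow | by lia].
move=> m s q /ltn_exp2_powR lt_m le_s /ltn_exp2_powR lt_q L rounds split A respects.
move/computes_on_average_card; have [->|s_gt0] := posnP s.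
  (* For [s = 0] the inverse is 0 by convention, so the lower bound is 0. *)
  by rewrite invr0 !mulr0 ler0n.
rewrite leqNgt; apply: contraNT; rewrite -ltNge => few.
apply: (few_rounds_fail _ erefl _ _ _ _ _ _ s_gt0 respects) => //.
  by move: le_s; rewrite ler_pdivlMr ?ltr0n // -natrM ler_nat mulnC.
move: few; rewrite mulrC !ltr_pdivlMr ?ltr0n //.
by rewrite -!natrM ltr_nat mulnA.
Qed.
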